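(* Let $(M,g)$ be a compact Riemannian manifold of dimension $n\ge 3$ whose metric is Chen–Nagano critical, i.e. there is a smooth 1-form $\theta$ on $M$ with $$E_g = B_g^*(\theta)+c\,g,\qquad c=-\frac{n-2}{2n}\,\bar s .$$ If $\theta$ is exact, $\theta=df$ with $f\in C^\infty(M)$, then this equation determines a gradient Ricci almost soliton structure $$\mathrm{Ric}_g-\mathrm{Hess}_g(f)=\lambda\, g,$$ where the soliton function $\lambda\in C^\infty(M)$ is given explicitly by $$\lambda=c+\tfrac12 s_g-\tfrac12\Delta_g f .$$
   Context: Manifolds are smooth and without boundary. $\mathrm{Ric}_g$ is the Ricci tensor, $s_g$ the scalar curvature, $E_g=\mathrm{Ric}_g-\tfrac12 s_g g$ the Einstein tensor, and $\bar s=\frac{1}{\mathrm{Vol}(M,g)}\int_M s_g\,dv_g$ the average scalar curvature. For a smooth 1-form $\theta$, $\delta\theta=-\nabla^i\theta_i$, $(\delta^*\theta)_{ij}=\tfrac12(\nabla_i\theta_j+\nabla_j\theta_i)$, and $B_g^*(\theta)=\delta^*\theta+\tfrac12(\delta\theta)\,g$. $\mathrm{Hess}_g(f)=\nabla df$ and $\Delta_g f=\mathrm{tr}_g(\mathrm{Hess}_g f)$. A gradient Ricci almost soliton structure on $(M,g)$ is a pair of smooth functions $(f,\lambda)$ with $\mathrm{Ric}_g-\mathrm{Hess}_g(f)=\lambda g$, where $\lambda$ is not required to be constant. *)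

(* Defs.v *)
From HB Require Import structures.
From mathcomp Require Import all_boot all_order all_algebra.
From mathcomp Require Import all_classical all_reals all_analysis.
Set Implicit Arguments.
Unset Strict Implicit.
Unset Printing Implicit Defensive.
Import Order.TTheory GRing.Theory Num.Theory.
Import numFieldNormedType.Exports.

Local Open Scope classical_set_scope.
Local Open Scope ring_scope.

Section Euclidean.
Variable R : realType.

Definition partial (n : nat) (a : 'I_n) (h : 'rV[R]_n -> R) : 'rV[R]_n -> R :=
  fun x => 'D_(delta_mx 0 a) h x.

Definition partials (n : nat) (s : seq 'I_n) (h : 'rV[R]_n -> R) :=
  foldr (@partial n) h s.

(* C^oo on U, meant for U open: all iterated partial derivatives exist and are
   continuous at every point of U. *)
Definition smooth_on (n : nat) (U : set 'rV[R]_n) (h : 'rV[R]_n -> R) : Prop :=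
  forall (s : seq 'I_n) (x : 'rV[R]_n), U x ->
    {for x, continuous (partials s h)} /\
    forall a : 'I_n, derivable (partials s h) x (delta_mx 0 a).

(* The n-dimensional Lebesgue integral as an iterated integral (Fubini); it is
   only applied to continuous functions with compact support. *)
Fixpoint integral_Rn (n : nat) : ('rV[R]_n -> R) -> R :=
  match n with
  | 0 => fun h => h 0
  | m.+1 => fun h => \int[lebesgue_measure]_t
      integral_Rn (fun v : 'rV[R]_m => h (row_mx (const_mx t : 'rV[R]_1) v))
  end.

End Euclidean.

(* param i is a total function, whose values outside coord i @` dom i are
   irrelevant. *)
Record smoothManifold (R : realType) (n : nat) := SmoothManifold {
  points :> topologicalType ;
  manifold_hausdorff : hausdorff_space points ;
  manifold_second_countable : @second_countable points ;
  chart : Type ;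
  dom : chart -> set points ;
  coord : chart -> points -> 'rV[R]_n ;
  param : chart -> 'rV[R]_n -> points ;
  dom_open : forall i, open (dom i) ;
  codom_open : forall i, open (coord i @` dom i) ;
  coordK : forall i p, dom i p -> param i (coord i p) = p ;
  coord_continuous : forall i, {within dom i, continuous (coord i)} ;
  param_continuous : forall i,
    {within coord i @` dom i, continuous (param i)} ;
  chart_cover : forall p, exists i, dom i p ;
  transition_smooth : forall i j (a : 'I_n),
    smooth_on (coord i @` (dom i `&` dom j))
              (fun x => coord j (param i x) 0 a)
}.

Section Manifold.
Variables (R : realType) (n : nat) (M : smoothManifold R n).
Implicit Types (i j : chart M) (p : M) (h f : M -> R).

Definition chart_at p : chart M := sval (cid (chart_cover p)).

Definition smooth_on_chart i h : Prop :=
  smooth_on (coord i @` dom i) (h \o param i).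

Definition smooth h : Prop := forall i, smooth_on_chart i h.

(* The partial derivative of h along the a-th coordinate of the chart i. *)
Definition pd i (a : 'I_n) h : M -> R :=
  fun p => partial a (h \o param i) (coord i p).

(* Entry (a, b) is the derivative of the b-th coordinate of the chart j along
   the a-th coordinate of the chart i. *)
Definition jac i j p : 'M[R]_n :=
  \matrix_(a, b) pd i a (fun q => coord j q 0 b) p.

(* Tensor fields are given by their components in each chart; the components
   in the chart i are irrelevant outside dom i. *)
Local Notation covector_field := (chart M -> M -> 'rV[R]_n).
Local Notation tensor2_field := (chart M -> M -> 'M[R]_n).

Definition covector_eq (s t : covector_field) : Prop :=
  forall i p, dom i p -> s i p = t i p.
Definition tensor2_eq (S T : tensor2_field) : Prop :=
  forall i p, dom i p -> S i p = T i p.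

Record oneForm := OneForm {
  oneForm_comp :> covector_field ;
  oneForm_smooth : forall i a, smooth_on_chart i (fun p => oneForm_comp i p 0 a) ;
  oneForm_change : forall i j p, dom i p -> dom j p ->
    oneForm_comp i p = oneForm_comp j p *m (jac i j p)^T
}.

Record riemannianMetric := RiemannianMetric {
  metric_comp :> tensor2_field ;
  metric_smooth : forall i a b, smooth_on_chart i (fun p => metric_comp i p a b) ;
  metric_change : forall i j p, dom i p -> dom j p ->
    metric_comp i p = jac i j p *m metric_comp j p *m (jac i j p)^T ;
  metric_sym : forall i p, dom i p -> (metric_comp i p)^T = metric_comp i p ;
  metric_pos : forall i p, dom i p -> forall v : 'rV[R]_n, v != 0 ->
    0 < (v *m metric_comp i p *m v^T) 0 0
}.

Definition differential f : covector_field := fun i p => \row_a pd i a f p.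

Variable g : riemannianMetric.

Definition ginv i p : 'M[R]_n := invmx (g i p).

(* christoffel i c a b is Gamma^c_{ab} for the Levi-Civita connection. *)
Definition christoffel i (c a b : 'I_n) : M -> R := fun p =>
  2^-1 * \sum_d ginv i p c d *
    (pd i a (fun q => g i q b d) p + pd i b (fun q => g i q a d) p
     - pd i d (fun q => g i q a b) p).

(* riemann i a b c d is the component along the d-th coordinate vector of
   R(e_a, e_b) e_c, where R(X, Y) = [nabla_X, nabla_Y] - nabla_[X, Y]. *)
Definition riemann i (a b c d : 'I_n) : M -> R := fun p =>
  pd i a (christoffel i d b c) p - pd i b (christoffel i d a c) p
  + \sum_e (christoffel i d a e p * christoffel i e b c p
            - christoffel i d b e p * christoffel i e a c p).

Definition Ric : tensor2_field := fun i p =>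
  \matrix_(b, c) \sum_a riemann i a b c a p.

(* The g-trace of a (0,2)-tensor field. It does not depend on the chart, so it
   is computed in a chosen chart around each point. *)
Definition trace_g (T : tensor2_field) : M -> R := fun p =>
  \sum_a \sum_b ginv (chart_at p) p a b * T (chart_at p) p a b.

Definition scal : M -> R := trace_g Ric.

Definition einstein : tensor2_field := fun i p =>
  Ric i p - (2^-1 * scal p) *: g i p.

(* Entry (a, b) is nabla_a t_b. *)
Definition nabla (t : covector_field) : tensor2_field := fun i p =>
  \matrix_(a, b) (pd i a (fun q => t i q 0 b) p
                  - \sum_c christoffel i c a b p * t i p 0 c).

Definition delta (t : covector_field) : M -> R := fun p => - trace_g (nabla t) p.

Definition deltastar (t : covector_field) : tensor2_field := fun i p =>
  2^-1 *: (nabla t i p + (nabla t i p)^T).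

Definition Bstar (t : covector_field) : tensor2_field := fun i p =>
  deltastar t i p + (2^-1 * delta t p) *: g i p.

Definition Hess f : tensor2_field := nabla (differential f).

Definition laplacian f : M -> R := trace_g (Hess f).

(* A finite smooth partition of unity on M, subordinate to chart domains. *)
Definition partition_of_unity (m : nat) (c : 'I_m -> chart M)
    (rho : 'I_m -> M -> R) : Prop :=
  [/\ forall k, smooth (rho k),
      forall k p, 0 <= rho k p,
      forall k, closure [set p | rho k p != 0] `<=` dom (c k)
    & forall p, \sum_(k < m) rho k p = 1].

Definition chart_integral i h : R :=
  integral_Rn ((fun x => h (param i x) * Num.sqrt (\det (g i (param i x))))
                 \_ (coord i @` dom i)).

(* The integral against dv_g of a continuous function on a compact M: the value
   does not depend on the partition of unity used to compute it. *)
Definition integral_dv h : R :=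
  xget 0 [set I : R | exists (m : nat) (c : 'I_m -> chart M)
                        (rho : 'I_m -> M -> R),
    partition_of_unity c rho /\
    I = \sum_(k < m) chart_integral (c k) (fun p => rho k p * h p)].

Definition volume : R := integral_dv (fun=> 1).

Definition average_scal : R := volume^-1 * integral_dv scal.

Definition CN_const : R := - ((n%:R - 2) / (2 * n%:R)) * average_scal.

Definition Chen_Nagano_equation (t : oneForm) : Prop :=
  tensor2_eq einstein (fun i p => Bstar t i p + CN_const *: g i p).

Definition gradient_Ricci_almost_soliton f (lam : M -> R) : Prop :=
  [/\ smooth f, smooth lam
    & tensor2_eq (fun i p => Ric i p - Hess f i p)
                 (fun i p => lam p *: g i p)].

End Manifold.

(* Main.v *)
Require Import Defs.
From mathcomp Require Import all_boot all_order all_algebra.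
From mathcomp Require Import all_classical all_reals all_analysis.
From mathcomp Require Import ring.
Set Implicit Arguments.
Unset Strict Implicit.
Unset Printing Implicit Defensive.
Import Order.TTheory GRing.Theory Num.Theory.
Import numFieldNormedType.Exports.
Local Open Scope classical_set_scope.
Local Open Scope ring_scope.

(* For an exact theta = df, the operator delta^* gives the Hessian of f: by
   Schwarz's theorem and the symmetry of the Christoffel symbols Hess f is
   symmetric. Moving the multiples of g to one side of the Chen-Nagano equation
   then gives Ric - Hess f = lambda g. Smoothness of lambda follows from this
   identity: the components of Ric, Hess f and g are smooth in every chart, and
   lambda is the quotient of two diagonal components, the one of g being
   positive. In this way the chart independence of the traces, which are computed
   in a chosen chart at each point, is not needed. *)

(** * Calculus of smooth functions on open subsets of R^n *)

Section SmoothFunctions.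
Context {R : realType} {n : nat}.
Implicit Types (U : set 'rV[R]_n) (h k : 'rV[R]_n -> R) (x : 'rV[R]_n).

Lemma partial_near_eq h k x (a : 'I_n) :
  (\near x, h x = k x) -> partial a h x = partial a k x.
Proof. exact: near_eq_derive. Qed.

Lemma partial_eq_on U h k (a : 'I_n) : open U -> (forall x, U x -> h x = k x) ->
  forall x, U x -> partial a h x = partial a k x.
Proof.
move=> oU hk x Ux; apply: partial_near_eq.
by apply: filterS (open_nbhs_nbhs (conj oU Ux)) => y Uy; apply: hk.
Qed.

(** Class C^m on [U], by recursion on the order. [smooth_on] offers no order on which to induct,
    whereas here the Leibniz and quotient rules reduce order [m.+1] to order [m]. *)
Fixpoint Ck_on U (m : nat) h : Prop :=
  (forall x, U x -> {for x, continuous h}) /\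
  match m with
  | 0 => True
  | m'.+1 => (forall x (a : 'I_n), U x -> derivable h x (delta_mx 0 a)) /\
             (forall a : 'I_n, Ck_on U m' (partial a h))
  end.

(** The last index of the list is the innermost derivative, the one that the recursion of [Ck_on]
    removes first. *)
Lemma partials_rcons (s : seq 'I_n) (a : 'I_n) h :
  partials (rcons s a) h = partials s (partial a h).
Proof. by rewrite /partials foldr_rcons. Qed.

Lemma smooth_on_partial U h (a : 'I_n) :
  smooth_on U h -> smooth_on U (partial a h).
Proof. by move=> sh s x Ux; rewrite -partials_rcons; apply: sh. Qed.

Lemma smooth_on_continuous U h x : smooth_on U h -> U x -> {for x, continuous h}.
Proof. by move=> sh Ux; have [] := sh [::] x Ux. Qed.

Lemma smooth_on_derivable U h x (a : 'I_n) :
  smooth_on U h -> U x -> derivable h x (delta_mx 0 a).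
Proof. by move=> sh Ux; have [_] := sh [::] x Ux; apply. Qed.

Lemma smooth_on_Ck U h : smooth_on U h <-> forall m, Ck_on U m h.
Proof.
split=> [sh m|].
  elim: m h sh => [|m IH] h sh; (split; first by move=> x; apply: smooth_on_continuous).
    by [].
  split=> [x a|a]; first exact: smooth_on_derivable.
  exact/IH/smooth_on_partial.
move=> ch s; elim/last_ind: s h ch => [|s a IH] h ch x Ux.
  by split=> [|a]; have [c [d _]] := ch 1%N; [exact: c|exact: d].
by rewrite partials_rcons; apply: IH => // m; have [_ [_]] := ch m.+1; apply.
Qed.

Lemma Ck_onW U m h : Ck_on U m.+1 h -> Ck_on U m h.
Proof.
elim: m h => [|m IH] h; first by case.
by case=> ch [dh ph]; split=> //; split=> // a; apply/IH/ph.
Qed.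

(** Since [U] is open, equality on [U] is equality near each of its points, which is all that limits
    and derivatives see. *)
Lemma Ck_on_eq U m h k : open U -> (forall x, U x -> h x = k x) ->
  Ck_on U m h -> Ck_on U m k.
Proof.
move=> oU; have near_U h1 h2 x : (forall x, U x -> h1 x = h2 x) ->
    U x -> \near x, h1 x = h2 x.
  move=> h12 Ux; apply: filterS (open_nbhs_nbhs (conj oU Ux)) => y Uy.
  exact: h12.
have cvg_U h1 h2 x : (forall x, U x -> h1 x = h2 x) -> U x ->
    {for x, continuous h1} -> {for x, continuous h2}.
  move=> h12 Ux ch1; rewrite /prop_for /continuous_at -(h12 x Ux).
  apply: cvg_trans ch1.
  exact: (@near_eq_cvg _ _ (nbhs x) _ _ _ (near_U _ _ _ h12 Ux)).
elim: m h k => [|m IH] h k hk [ch H];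
  (split; first by move=> x Ux; apply: cvg_U hk _ (ch x Ux)) => //.
case: H => dh ph; split=> [x a Ux|a].
  exact: near_eq_derivable (near_U _ _ _ hk Ux) (dh x a Ux).
exact: (IH (partial a h) _ (partial_eq_on a oU hk) (ph a)).
Qed.

Lemma smooth_on_eq U h k :
  open U -> (forall x, U x -> h x = k x) -> smooth_on U h -> smooth_on U k.
Proof.
by move=> oU hk /smooth_on_Ck sh; apply/smooth_on_Ck => m; apply: Ck_on_eq (sh m).
Qed.

Lemma smooth_on_cst U (c : R) : smooth_on U (fun=> c).
Proof.
apply/smooth_on_Ck => m.
elim: m c => [|m IH] c; (split; first by move=> x _; exact: cst_continuous) => //.
split=> [x a _|a]; first exact: derivable_cst.
rewrite [partial _ _](_ : _ = fun=> 0); first exact: IH.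
by apply/funext => x; rewrite /partial derive_cst.
Qed.

Lemma Ck_onD U m h k : open U ->
  Ck_on U m h -> Ck_on U m k -> Ck_on U m (fun x => h x + k x).
Proof.
move=> oU; elim: m h k => [|m IH] h k [ch Hh] [ck Hk];
  (split; first by move=> x Ux; exact: (continuousD (ch x Ux) (ck x Ux))) => //.
case: Hh Hk => dh ph [dk pk]; split=> [x a Ux|a].
  by apply: derivableD; [exact: dh|exact: dk].
apply: (Ck_on_eq oU _ (IH _ _ (ph a) (pk a))) => x Ux.
by rewrite /partial deriveD; [|exact: dh|exact: dk].
Qed.

(** The Leibniz rule expresses the derivative through the factors themselves as well as their
    derivatives, so the induction also needs the factors at the lower order, given by [Ck_onW]. *)
Lemma Ck_onM U m h k : open U ->
  Ck_on U m h -> Ck_on U m k -> Ck_on U m (fun x => h x * k x).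
Proof.
move=> oU; elim: m h k => [|m IH] h k Ch Ck; have := Ch; have := Ck;
  move=> [ck Hk] [ch Hh];
  (split; first by move=> x Ux; exact: (continuousM (ch x Ux) (ck x Ux))) => //.
case: Hh Hk => dh ph [dk pk]; split=> [x a Ux|a].
  by apply: derivableM; [exact: dh|exact: dk].
apply: (Ck_on_eq oU _ (Ck_onD oU (IH _ _ (Ck_onW Ch) (pk a))
  (IH _ _ (Ck_onW Ck) (ph a)))) => x Ux.
by rewrite /partial deriveM; [|exact: dh|exact: dk].
Qed.

(** The derivative of 1/h is -1 times (1/h)(1/h) times the derivative of h; the induction hypothesis
    covers 1/h at order [m], and products are already settled. *)
Lemma Ck_onV U m h : open U -> (forall x, U x -> h x != 0) ->
  Ck_on U m h -> Ck_on U m (fun x => (h x)^-1).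
Proof.
move=> oU h0; elim: m h h0 => [|m IH] h h0 Ch; have := Ch;
  move=> [ch Hh];
  (split; first by move=> x Ux; exact: (continuousV (h0 x Ux) (ch x Ux))) => //.
case: Hh => dh ph; split=> [x a Ux|a].
  by apply: derivableV; [exact: h0|exact: dh].
have CV := IH _ h0 (Ck_onW Ch).
have C1 : Ck_on U m (fun=> -1 : R)
  by exact: (proj1 (smooth_on_Ck _ _) (smooth_on_cst _) m).
apply: (Ck_on_eq oU _ (Ck_onM oU C1 (Ck_onM oU (Ck_onM oU CV CV) (ph a)))).
move=> x Ux; rewrite /partial deriveV; [|exact: h0|exact: dh].
by rewrite /GRing.scale/= mulN1r mulNr expr2 invfM.
Qed.

Lemma smooth_onD U h k : open U ->
  smooth_on U h -> smooth_on U k -> smooth_on U (fun x => h x + k x).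
Proof.
by move=> oU /smooth_on_Ck sh /smooth_on_Ck sk; apply/smooth_on_Ck => m; apply: Ck_onD.
Qed.

Lemma smooth_onM U h k : open U ->
  smooth_on U h -> smooth_on U k -> smooth_on U (fun x => h x * k x).
Proof.
by move=> oU /smooth_on_Ck sh /smooth_on_Ck sk; apply/smooth_on_Ck => m; apply: Ck_onM.
Qed.

Lemma smooth_onV U h : open U -> (forall x, U x -> h x != 0) ->
  smooth_on U h -> smooth_on U (fun x => (h x)^-1).
Proof.
by move=> oU h0 /smooth_on_Ck sh; apply/smooth_on_Ck => m; apply: Ck_onV.
Qed.

Lemma smooth_onN U h : open U -> smooth_on U h -> smooth_on U (fun x => - h x).
Proof.
move=> oU sh; under [fun x => _]funext do rewrite -mulN1r.
by apply: smooth_onM => //; apply: smooth_on_cst.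
Qed.

Lemma smooth_on_sum U (I : Type) (r : seq I) (F : I -> 'rV[R]_n -> R) : open U ->
  (forall i, smooth_on U (F i)) -> smooth_on U (fun x => \sum_(i <- r) F i x).
Proof.
move=> oU sF; elim: r => [|i r IH].
  under [fun x => _]funext do rewrite big_nil.
  exact: smooth_on_cst.
under [fun x => _]funext do rewrite big_cons.
exact: smooth_onD.
Qed.

Lemma smooth_on_prod U (I : Type) (r : seq I) (F : I -> 'rV[R]_n -> R) : open U ->
  (forall i, smooth_on U (F i)) -> smooth_on U (fun x => \prod_(i <- r) F i x).
Proof.
move=> oU sF; elim: r => [|i r IH].
  under [fun x => _]funext do rewrite big_nil.
  exact: smooth_on_cst.
under [fun x => _]funext do rewrite big_cons.
exact: smooth_onM.
Qed.

Lemma smooth_on_det U (m : nat) (A : 'rV[R]_n -> 'M[R]_m) : open U ->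
  (forall a b, smooth_on U (fun x => A x a b)) ->
  smooth_on U (fun x => \det (A x)).
Proof.
move=> oU sA; rewrite /determinant; apply: smooth_on_sum => // s.
apply: smooth_onM => //; first exact: smooth_on_cst.
by apply: smooth_on_prod.
Qed.

(** Cramer's rule: on [U] each entry of the inverse is a cofactor divided by the nonvanishing
    determinant, and both are polynomials in the entries of [A]. *)
Lemma smooth_on_invmx U (m : nat) (A : 'rV[R]_n -> 'M[R]_m) : open U ->
  (forall x, U x -> A x \in unitmx) ->
  (forall a b, smooth_on U (fun x => A x a b)) ->
  forall a b, smooth_on U (fun x => invmx (A x) a b).
Proof.
move=> oU uA sA a b.
apply: (@smooth_on_eq U (fun x => (\det (A x))^-1 * cofactor (A x) b a)) => //.
  by move=> x Ux; rewrite /invmx uA// !mxE.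
apply: smooth_onM => //.
  apply: smooth_onV => //; last exact: smooth_on_det.
  by move=> x /uA; rewrite unitmxE unitfE.
rewrite /cofactor; apply: smooth_onM => //; first exact: smooth_on_cst.
apply: smooth_on_det => // c d.
by under [fun x => _]funext do rewrite !mxE; apply: sA.
Qed.

End SmoothFunctions.

(** * Schwarz's theorem on mixed derivatives *)

Section MixedPartials.
Context {R : realType} {n : nat}.
Implicit Types (U : set 'rV[R]_n) (h : 'rV[R]_n -> R) (x v w : 'rV[R]_n).

(** Restricting to the line through [x] along [v] leaves the difference quotient unchanged, so
    directional derivatives become ordinary ones, to which the mean value theorem applies. *)
Lemma is_derive_line h x v (t : R) : derivable h (x + t *: v) v ->
  is_derive t 1 (fun s : R => h (x + s *: v)) ('D_v h (x + t *: v)).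
Proof.
move=> dh.
have E : (fun s : R => s^-1 *: (((fun s : R => h (x + s *: v)) \o shift t) (s *: 1)
            - h (x + t *: v))) =
         (fun s : R => s^-1 *: ((h \o shift (x + t *: v)) (s *: v) - h (x + t *: v))).
  apply/funext => s /=; congr (_ *: (h _ - _)).
  by rewrite [s *: 1]mulr1 scalerDl addrCA.
by split; rewrite ?/derivable /derive E.
Qed.

(* Mean value theorem applied twice to the second difference of [h]. *)
Lemma second_difference_MVT h x v w (r : R) : 0 < r ->
  (forall s t : R, 0 <= s <= r -> 0 <= t <= r ->
     derivable h (x + t *: w + s *: v) v) ->
  (forall s t : R, 0 <= s <= r -> 0 <= t <= r ->
     derivable ('D_v h) (x + s *: v + t *: w) w) ->
  exists s t : R, [/\ 0 <= s <= r, 0 <= t <= r &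
    h (x + r *: w + r *: v) - h (x + r *: v) - h (x + r *: w) + h x =
    'D_w ('D_v h) (x + s *: v + t *: w) * r ^+ 2].
Proof.
move=> r0 d1 d2.
have z0 : 0 <= (0 : R) <= r by rewrite lexx ltW.
have rr : 0 <= r <= r by rewrite lexx ltW.
(* The second difference is [F r - F 0], hence [dF s * r] for some [s]; in turn [dF s] is
   [G r - G 0] for the function [G] below. *)
pose F (s : R) := h (x + r *: w + s *: v) - h (x + s *: v).
pose dF (s : R) := 'D_v h (x + r *: w + s *: v) - 'D_v h (x + s *: v).
have dFP (s : R) : 0 <= s <= r -> is_derive s 1 F (dF s).
  move=> sr; apply: is_deriveB; apply: is_derive_line; first exact: (d1 s r sr rr).
  by have := d1 s 0 sr z0; rewrite scale0r addr0.
have [||s sr Fs] := MVT (f := F) (df := dF) r0.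
- by move=> s; rewrite in_itv/= => /andP[s0 s1]; apply: dFP; rewrite (ltW s0) (ltW s1).
- apply: derivable_within_continuous => s; rewrite in_itv/= => sr.
  by have [] := dFP s sr.
have {}sr : 0 <= s <= r.
  by move: sr; rewrite in_itv/= => /andP[p q]; rewrite (ltW p) (ltW q).
pose G (t : R) := 'D_v h (x + s *: v + t *: w).
pose dG (t : R) := 'D_w ('D_v h) (x + s *: v + t *: w).
have dGP (t : R) : 0 <= t <= r -> is_derive t 1 G (dG t).
  by move=> tr; apply: is_derive_line; exact: d2.
have [||t tr Gt] := MVT (f := G) (df := dG) r0.
- by move=> t; rewrite in_itv/= => /andP[t0 t1]; apply: dGP; rewrite (ltW t0) (ltW t1).
- apply: derivable_within_continuous => t; rewrite in_itv/= => tr.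
  by have [] := dGP t tr.
exists s, t; split=> //.
  by move: tr; rewrite in_itv/= => /andP[p q]; rewrite (ltW p) (ltW q).
move: Fs Gt; rewrite /F /dF /G /dG !scale0r !addr0 !subr0 => Fs Gt.
rewrite [x + r *: w + s *: v]addrAC Gt in Fs.
by rewrite expr2 mulrA -Fs; ring.
Qed.

Lemma nbhs_parallelogram x v w (P : set 'rV[R]_n) : nbhs x P ->
  exists2 r : R, 0 < r &
    forall s t : R, 0 <= s <= r -> 0 <= t <= r -> P (x + s *: v + t *: w).
Proof.
move=> /nbhs_ballP[e /= e0 eP].
(* The summand 1 keeps [c] positive even if [v] and [w] vanish; the factor 2 in the radius makes the
   final bound e/2, strictly below [e]. *)
pose c := `|v| + `|w| + 1.
have c0 : 0 < c by rewrite ltr_wpDl// addr_ge0.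
exists (e / (2 * c)); first by rewrite divr_gt0// mulr_gt0.
move=> s t /andP[s0 sr] /andP[t0 tr]; apply: eP.
rewrite -ball_normE /ball_/= -addrA opprD addNKr normrN.
apply: (le_lt_trans (ler_normD _ _)); rewrite !normrZ !ger0_norm//.
apply: (@le_lt_trans _ _ (e / (2 * c) * c)).
  apply: (@le_trans _ _ (e / (2 * c) * `|v| + e / (2 * c) * `|w|)).
    by apply: lerD; apply: ler_wpM2r.
  rewrite -mulrDr; apply: ler_wpM2l; last by rewrite /c lerDl.
  by rewrite ltW// divr_gt0// mulr_gt0.
rewrite invfM mulrA -mulrA mulVf ?gt_eqF// mulr1.
by rewrite ltr_pdivrMr// ltr_pMr// ltr1n.
Qed.

(** The second difference over a small parallelogram is symmetric in [v] and [w]. Computed in both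
    orders, it equates values of the two mixed derivatives at two points near [x]; by continuity
    each value is within e/2 of the one at [x]. *)
Lemma schwarz U h x v w : open U -> U x ->
  (forall y, U y -> derivable h y v) ->
  (forall y, U y -> derivable h y w) ->
  (forall y, U y -> derivable ('D_v h) y w) ->
  (forall y, U y -> derivable ('D_w h) y v) ->
  {for x, continuous ('D_w ('D_v h))} ->
  {for x, continuous ('D_v ('D_w h))} ->
  'D_w ('D_v h) x = 'D_v ('D_w h) x.
Proof.
move=> oU Ux dv dw dvw dwv cvw cwv.
apply/eqP; rewrite -subr_eq0 -normr_le0; apply/ler_addgt0Pl => e e0; rewrite addr0.
have e20 : 0 < e / 2 by rewrite divr_gt0.
have Nvw : \forall y \near x, `|'D_w ('D_v h) x - 'D_w ('D_v h) y| < e / 2.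
  by move/cvgrPdist_lt : cvw; apply.
have Nwv : \forall y \near x, `|'D_v ('D_w h) x - 'D_v ('D_w h) y| < e / 2.
  by move/cvgrPdist_lt : cwv; apply.
have NU : \forall y \near x, U y by apply: open_nbhs_nbhs.
have [r r0 Hr] := nbhs_parallelogram v w (filterI NU (filterI Nvw Nwv)).
have C s t : x + t *: w + s *: v = x + s *: v + t *: w by rewrite addrAC.
have [s [t [sr tr E1]]] := @second_difference_MVT h x v w r r0
  ltac:(by move=> s t sr tr; rewrite C; apply: dv; have [] := Hr s t sr tr)
  ltac:(by move=> s t sr tr; apply: dvw; have [] := Hr s t sr tr).
have [t' [s' [tr' sr' E2]]] := @second_difference_MVT h x w v r r0
  ltac:(by move=> s' t' sr' tr'; apply: dw; have [] := Hr t' s' tr' sr')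
  ltac:(by move=> s' t' sr' tr'; rewrite C; apply: dwv; have [] := Hr t' s' tr' sr').
have [_ [A _]] := Hr s t sr tr.
have [_ [_ B]] := Hr s' t' sr' tr'.
(* Both left-hand sides are brought to the same expression, so that [r ^+ 2] can be cancelled. *)
move: E2; rewrite C => E2; move: E1; rewrite C [_ - _ - _]addrAC => E1.
have r2 : r ^+ 2 != 0 by rewrite expf_neq0// gt_eqF.
have close (p q p' q' : R) : p' = q' ->
    `|p - p'| < e / 2 -> `|q - q'| < e / 2 -> `|p - q| <= e.
  move=> -> pq qq; rewrite (_ : p - q = (p - q') - (q - q')); last by ring.
  by apply: (le_trans (ler_normB _ _)); rewrite [e]splitr ltW// ltrD.
exact: (close _ _ _ _ (mulIf r2 (etrans (esym E1) E2)) A B).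
Qed.

Lemma smooth_on_partialC U h x (a b : 'I_n) : open U -> smooth_on U h -> U x ->
  partial a (partial b h) x = partial b (partial a h) x.
Proof.
move=> oU sh Ux.
apply: (schwarz oU Ux); do ?by move=> y; apply: smooth_on_derivable;
  do ?apply: smooth_on_partial.
all: by apply: (smooth_on_continuous _ Ux); do 2?apply: smooth_on_partial.
Qed.

End MixedPartials.

(** * Functions on the manifold read in a chart *)

Section Charts.
Context {R : realType} {n : nat} {M : smoothManifold R n}.
Implicit Types (i : chart M) (p : M) (h k f : M -> R) (a b c d : 'I_n).

Lemma paramK i x : (Defs.coord i @` dom i) x ->
  dom i (param i x) /\ Defs.coord i (param i x) = x.
Proof. by case=> p ip <-; rewrite Defs.coordK. Qed.

(** The image of a chart is open, so agreement on [dom i] is enough. This matters because components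
    of tensors carry meaning only there. *)
Lemma pd_eq_on i a h k : (forall p, dom i p -> h p = k p) ->
  forall p, dom i p -> pd i a h p = pd i a k p.
Proof.
move=> hk p ip; rewrite /pd.
apply: (partial_eq_on (U := Defs.coord i @` dom i)); [exact: codom_open| |by exists p].
by move=> x /paramK[+ _]; exact: hk.
Qed.

Lemma pd_param i a h x : (Defs.coord i @` dom i) x ->
  pd i a h (param i x) = partial a (h \o param i) x.
Proof. by rewrite /pd => /paramK[_ ->]. Qed.

Lemma smooth_on_chart_eq i h k : (forall p, dom i p -> h p = k p) ->
  smooth_on_chart i h -> smooth_on_chart i k.
Proof.
move=> hk sh; apply: (smooth_on_eq (@codom_open _ _ _ i) _ sh) => x /paramK[+ _].
exact: hk.
Qed.

(** [pd i a h] composed with [param i] is the Euclidean partial derivative only on the image of the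
    chart, where [param i] is a right inverse of the coordinates. *)
Lemma smooth_on_chart_pd i a h :
  smooth_on_chart i h -> smooth_on_chart i (pd i a h).
Proof.
move=> /(smooth_on_partial a) sh.
apply: (smooth_on_eq (@codom_open _ _ _ i) _ sh) => x Ux.
by rewrite -pd_param.
Qed.

Lemma smooth_on_chart_cst i (r : R) : smooth_on_chart i (fun=> r).
Proof. exact: smooth_on_cst. Qed.

Lemma smooth_on_chartD i h k : smooth_on_chart i h -> smooth_on_chart i k ->
  smooth_on_chart i (fun p => h p + k p).
Proof. exact: (smooth_onD (@codom_open _ _ _ i)). Qed.

Lemma smooth_on_chartN i h : smooth_on_chart i h -> smooth_on_chart i (fun p => - h p).
Proof. exact: (smooth_onN (@codom_open _ _ _ i)). Qed.

Lemma smooth_on_chartM i h k : smooth_on_chart i h -> smooth_on_chart i k ->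
  smooth_on_chart i (fun p => h p * k p).
Proof. exact: (smooth_onM (@codom_open _ _ _ i)). Qed.

Lemma smooth_on_chartV i h : (forall p, dom i p -> h p != 0) ->
  smooth_on_chart i h -> smooth_on_chart i (fun p => (h p)^-1).
Proof.
move=> h0 sh; apply: (smooth_onV (@codom_open _ _ _ i) _ sh) => x /paramK[+ _].
exact: h0.
Qed.

Lemma smooth_on_chart_sum i (I : Type) (r : seq I) (F : I -> M -> R) :
  (forall e, smooth_on_chart i (F e)) ->
  smooth_on_chart i (fun p => \sum_(e <- r) F e p).
Proof. exact: (smooth_on_sum r (@codom_open _ _ _ i)). Qed.

Lemma pdC i a b f p : smooth_on_chart i f -> dom i p ->
  pd i a (pd i b f) p = pd i b (pd i a f) p.
Proof.
move=> sf ip; have Up : (Defs.coord i @` dom i) (Defs.coord i p) by exists p.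
have oU := @codom_open _ _ M i.
have pd2 c d : pd i c (pd i d f) p =
    partial c (partial d (f \o param i)) (Defs.coord i p).
  by apply: (partial_eq_on c oU _ Up) => x; exact: pd_param.
by rewrite !pd2; exact: smooth_on_partialC oU sf Up.
Qed.

End Charts.

(** * Smoothness and symmetry of the geometric tensors *)

Section Curvature.
Context {R : realType} {n : nat} {M : smoothManifold R n} (g : riemannianMetric M).
Implicit Types (i : chart M) (p : M) (f : M -> R) (a b c d : 'I_n).

(** A nonzero vector in the kernel would have length zero, against positivity. *)
Lemma metric_unitmx i p : dom i p -> g i p \in unitmx.
Proof.
move=> ip; rewrite unitmxE unitfE; apply/det0P => -[v v0 vg].
by have := metric_pos g ip v0; rewrite vg mul0mx mxE ltxx.
Qed.

Lemma metric_diag_gt0 i p a : dom i p -> 0 < g i p a a.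
Proof.
move=> ip; have e0 : delta_mx 0 a != 0 :> 'rV[R]_n.
  apply/eqP => /matrixP /(_ 0 a); rewrite !mxE !eqxx => /eqP.
  by rewrite oner_eq0.
by have := metric_pos g ip e0; rewrite -rowE trmx_delta -colE !mxE.
Qed.

Lemma smooth_ginv i a b : smooth_on_chart i (fun p => ginv g i p a b).
Proof.
apply: (smooth_on_invmx (@codom_open _ _ _ i) (A := fun x => g i (param i x)))
  => [x /paramK[ix _]|c d].
  exact: metric_unitmx.
exact: metric_smooth.
Qed.

Lemma smooth_christoffel i c a b : smooth_on_chart i (christoffel g i c a b).
Proof.
apply: smooth_on_chartM; first exact: smooth_on_chart_cst.
apply: smooth_on_chart_sum => d.
apply: smooth_on_chartM; first exact: smooth_ginv.
apply: smooth_on_chartD; last exact/smooth_on_chartN/smooth_on_chart_pd/metric_smooth.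
by apply: smooth_on_chartD; exact/smooth_on_chart_pd/metric_smooth.
Qed.

Lemma smooth_riemann i a b c d : smooth_on_chart i (riemann g i a b c d).
Proof.
apply: smooth_on_chartD.
  by apply: smooth_on_chartD; last apply: smooth_on_chartN;
    exact/smooth_on_chart_pd/smooth_christoffel.
apply: smooth_on_chart_sum => e.
by apply: smooth_on_chartD; last apply: smooth_on_chartN;
  apply: smooth_on_chartM; exact: smooth_christoffel.
Qed.

Lemma smooth_Ric i a b : smooth_on_chart i (fun p => Ric g i p a b).
Proof.
under [fun p => _]funext do rewrite mxE.
by apply: smooth_on_chart_sum => c; exact: smooth_riemann.
Qed.

Lemma smooth_Hess f i a b : smooth f -> smooth_on_chart i (fun p => Hess g f i p a b).
Proof.
move=> sf; under [fun p => _]funext do rewrite mxE.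
have sdf c : smooth_on_chart i (fun p => differential f i p 0 c).
  by under [fun p => _]funext do rewrite mxE; exact/smooth_on_chart_pd/sf.
apply: smooth_on_chartD; first exact: smooth_on_chart_pd.
apply/smooth_on_chartN/smooth_on_chart_sum => c.
by apply: smooth_on_chartM; [exact: smooth_christoffel|exact: sdf].
Qed.

(** Exchanging [a] and [b] swaps the first two derivatives of the metric and fixes the third by
    symmetry of [g], known on [dom i]. *)
Lemma christoffel_sym i c a b p : dom i p ->
  christoffel g i c a b p = christoffel g i c b a p.
Proof.
move=> ip; congr (_ * _); apply: eq_bigr => d _; congr (_ * (_ - _)).
  by rewrite addrC.
by apply: pd_eq_on ip => q iq; rewrite -[in LHS](Defs.metric_sym g iq) mxE.
Qed.

Lemma Hess_sym f i p : smooth f -> dom i p -> (Hess g f i p)^T = Hess g f i p.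
Proof.
move=> sf ip; apply/matrixP => a b; rewrite !mxE; congr (_ - _).
  have pd_df c d : pd i c (fun q => differential f i q 0 d) p = pd i c (pd i d f) p.
    by apply: pd_eq_on ip => q _; rewrite mxE.
  by rewrite !pd_df; apply: pdC.
by apply: eq_bigr => c _; rewrite christoffel_sym.
Qed.

Lemma nabla_eq (s t : chart M -> M -> 'rV[R]_n) :
  covector_eq s t -> tensor2_eq (nabla g s) (nabla g t).
Proof.
move=> st i p ip; apply/matrixP => a b; rewrite !mxE (st i p ip); congr (_ - _).
by apply: pd_eq_on ip => q iq; rewrite st.
Qed.

Lemma chart_atP p : dom (chart_at p) p.
Proof. exact: (svalP (cid (chart_cover p))). Qed.

(** The trace at [p] uses a chart containing [p], so equality on chart domains yields equality of
    functions on all of [M]. *)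
Lemma trace_g_eq (S T : chart M -> M -> 'M[R]_n) :
  tensor2_eq S T -> trace_g g S = trace_g g T.
Proof.
move=> ST; apply/funext => p; apply: eq_bigr => a _; apply: eq_bigr => b _.
by rewrite ST//; exact: chart_atP.
Qed.

(** Symmetrising the symmetric Hessian returns it, and the codifferential of df is minus the
    Laplacian, whence the sign of the trace term. *)
Lemma Bstar_exact (t : chart M -> M -> 'rV[R]_n) f : smooth f ->
  covector_eq t (differential f) ->
  tensor2_eq (Bstar g t) (fun i p => Hess g f i p - (2^-1 * laplacian g f p) *: g i p).
Proof.
move=> sf /nabla_eq tf i p ip.
rewrite /Bstar /deltastar /delta (trace_g_eq tf) tf// -/(Hess g f) Hess_sym//.
by rewrite -mulr2n -[Hess _ _ _ _ *+ 2]scaler_nat scalerA mulVf ?pnatr_eq0//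
  scale1r mulrN scaleNr.
Qed.

(* Reading off a diagonal entry exhibits [lam] as [T_00 / g_00] in every chart. *)
Lemma smooth_conformal_factor (T : chart M -> M -> 'M[R]_n) (lam : M -> R) :
  (0 < n)%N -> (forall i a b, smooth_on_chart i (fun p => T i p a b)) ->
  tensor2_eq T (fun i p => lam p *: g i p) -> smooth lam.
Proof.
move=> n0 sT Tg i; pose z := Ordinal n0.
apply: (@smooth_on_chart_eq _ _ _ _ (fun p => T i p z z * (g i p z z)^-1)).
  by move=> p ip; rewrite Tg// mxE mulfK// gt_eqF// metric_diag_gt0.
apply: smooth_on_chartM => //; apply: smooth_on_chartV; last exact: metric_smooth.
by move=> p ip; rewrite gt_eqF// metric_diag_gt0.
Qed.

End Curvature.

Theorem theorem4p1 (R : realType) (n : nat) (M : smoothManifold R n)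
    (g : riemannianMetric M) (theta : oneForm M) (f : M -> R)
    (M_compact : compact [set: M])
    (n_ge3 : (3 <= n)%N)
    (g_critical : Chen_Nagano_equation g theta)
    (f_smooth : smooth f)
    (theta_exact : covector_eq theta (differential f)) :
  gradient_Ricci_almost_soliton g f
    (fun p : M => CN_const g + 2^-1 * scal g p - 2^-1 * laplacian g f p).
Proof.
set lam := (fun p => _).
have soliton : tensor2_eq (fun i p => Ric g i p - Hess g f i p)
                          (fun i p => lam p *: g i p).
  move=> i p ip; have := g_critical i p ip.
  rewrite (Bstar_exact g f_smooth theta_exact)// /einstein => /eqP.
  rewrite subr_eq => /eqP ->; rewrite /lam.
  (* What remains is an identity linear in the entries of the Hessian and the metric; generalising
     both keeps [mxE] from unfolding the Hessian. *)
  move: (Hess g f i p) (g i p) => H G.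
  by apply/matrixP => a b; rewrite !mxE; ring.
(* The soliton identity itself shows that [lam] is smooth; the dimension bound supplies a diagonal
   entry to divide by. *)
split=> //; apply: smooth_conformal_factor soliton; first by case: (n) n_ge3.
move=> i a b.
apply: (smooth_on_chart_eq (h := fun p => Ric g i p a b - Hess g f i p a b)).
  by move=> p _; rewrite [RHS]mxE; congr (_ + _); rewrite [RHS]mxE.
apply: smooth_on_chartD; first exact: smooth_Ric.
exact/smooth_on_chartN/smooth_Hess.
Qed.
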